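(* Let $q\in\mathbb C$ with $0<|q|<1$, $z\in\mathbb C\setminus\{0\}$, $x=\frac12(z+z^{-1})\neq0$, $\gamma,a,b,c,t\in\mathbb C\setminus\{0\}$ with $|t|<1$ and $|abct|<1$, and $\frac1{ab},\frac1{ac},\gamma abct\notin\{q^{-k}:k\in\mathbb N_0\}$. Then the continuous dual $q^{-1}$-Hahn polynomials $p_n(x;a,b,c|q^{-1})$ satisfy $$\sum_{n=0}^\infty\frac{t^n(\gamma;q)_n\,q^{2\binom n2}\,p_n(x;a,b,c|q^{-1})}{(q,\frac1{ab},\frac1{ac};q)_n}=\frac{(\gamma abct;q)_\infty}{(abct;q)_\infty}\;{}_3\phi_3\left(\gamma,\,\frac za,\,\frac1{az};\ \frac1{ab},\,\frac1{ac},\,\gamma abct;\ q,at\right).$$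
   Context: $\mathbb N_0=\{0,1,2,\dots\}$. $(a;q)_n=\prod_{j=0}^{n-1}(1-aq^j)$ for $n\in\mathbb N_0\cup\{\infty\}$, $(a_1,\dots,a_k;q)_n=\prod_i(a_i;q)_n$, and $${}_r\phi_s(a_1,\dots,a_r;b_1,\dots,b_s;q,w)=\sum_{k\ge0}\frac{(a_1,\dots,a_r;q)_k}{(q,b_1,\dots,b_s;q)_k}\left((-1)^kq^{\binom k2}\right)^{1+s-r}w^k .$$ The continuous dual $q^{-1}$-Hahn polynomials, for $x=\frac12(z+z^{-1})$, are $$p_n(x;a,b,c|q^{-1})=q^{-2\binom n2}(abc)^n\left(\tfrac1{ab},\tfrac1{ac};q\right)_n\;{}_3\phi_2\left(q^{-n},\frac za,\frac1{az};\ \frac1{ab},\frac1{ac};\ q,\frac{q^n}{bc}\right).$$ *)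

(* Defs.v *)
From Stdlib Require Import Reals ZArith List FunctionalExtensionality.
From Coquelicot Require Import Coquelicot.
Import ListNotations.
Open Scope C_scope.

(** Limits and sums in C, in the style of Coquelicot's [RInt]: the value is
    meaningful only when the sequence, resp. the series, converges. *)
Definition CLim_seq (u : nat -> C) : C :=
  @iota C_CompleteNormedModule (fun l : C => filterlim u eventually (locally l)).

Definition CSeries (u : nat -> C) : C :=
  @iota C_CompleteNormedModule (fun l : C => is_series u l).

Lemma CLim_seq_unique (u : nat -> C) (l : C) :
  filterlim u eventually (locally l) -> CLim_seq u = l.
Proof.
  intros Hl.
  apply (@iota_filterlim_locally C_AbsRing C_CompleteNormedModule); [|exact Hl].
  apply Proper_StrongProper, eventually_filter.
Qed.

Lemma CSeries_unique (u : nat -> C) (l : C) : is_series u l -> CSeries u = l.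
Proof. exact (CLim_seq_unique (sum_n u) l). Qed.

Definition Cpow_Z (w : C) (m : Z) : C :=
  match m with
  | Z0 => 1
  | Zpos p => w ^ Pos.to_nat p
  | Zneg p => / (w ^ Pos.to_nat p)
  end.

Definition binom2 (n : nat) : nat := (n * (n - 1) / 2)%nat.

(** [(a;q)_n], [(a;q)_oo] and [(a_1,...,a_k;q)_n]. *)
Fixpoint qpoch (a q : C) (n : nat) : C :=
  match n with
  | O => 1
  | S m => qpoch a q m * (1 - a * q ^ m)
  end.

Definition qpoch_inf (a q : C) : C := CLim_seq (qpoch a q).

Definition qpochs (l : list C) (q : C) (n : nat) : C :=
  fold_right (fun a r => qpoch a q n * r) 1 l.

(** The summand and the sum of [r phi s (a_1..a_r; b_1..b_s; q, w)]. *)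
Definition qhyp_term (la lb : list C) (q w : C) (k : nat) : C :=
  qpochs la q k / qpochs (q :: lb) q k
  * Cpow_Z ((- (1)) ^ k * q ^ binom2 k)
           (1 + Z.of_nat (length lb) - Z.of_nat (length la))
  * w ^ k.

Definition qhyp (la lb : list C) (q w : C) : C := CSeries (qhyp_term la lb q w).

Definition cdqinv_Hahn_param (n : nat) (z a b c q : C) : C :=
  / q ^ (2 * binom2 n) * (a * b * c) ^ n
  * qpochs [/ (a * b); / (a * c)] q n
  * qhyp [/ q ^ n; z / a; / (a * z)] [/ (a * b); / (a * c)] q (q ^ n / (b * c)).

(** [p_n(x;a,b,c|q^-1)] as a function of [x]: the value of the formula above at
    any [z] with [x = (z + 1/z)/2].  Such [z] exists and is unique up to
    [z <-> 1/z], which leaves the formula unchanged; see [cdqinv_HahnE]. *)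
Definition cdqinv_Hahn (n : nat) (x a b c q : C) : C :=
  @iota C_CompleteNormedModule (fun y : C =>
    exists z : C, z <> 0 /\ x = (z + / z) / 2
                  /\ y = cdqinv_Hahn_param n z a b c q).

Lemma cdqinv_Hahn_param_sym (n : nat) (z a b c q : C) :
  z <> 0 -> a <> 0 ->
  cdqinv_Hahn_param n (/ z) a b c q = cdqinv_Hahn_param n z a b c q.
Proof.
  intros Hz Ha. unfold cdqinv_Hahn_param, qhyp. do 2 f_equal.
  assert (E1 : / z / a = / (a * z)) by (field; auto).
  assert (E2 : / (a * / z) = z / a) by (field; auto).
  rewrite E1, E2.
  apply functional_extensionality; intros k.
  unfold qhyp_term; simpl qpochs; simpl length. do 2 f_equal.
  unfold Cdiv; f_equal. ring.
Qed.

Lemma cdqinv_HahnE (n : nat) (z a b c q : C) :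
  z <> 0 -> a <> 0 ->
  cdqinv_Hahn n ((z + / z) / 2) a b c q = cdqinv_Hahn_param n z a b c q.
Proof.
  intros Hz Ha.
  apply (@iota_unique C_AbsRing C_CompleteNormedModule).
  - intros y [w [Hw [E ->]]].
    assert (H : (z - w) * (z * w - 1) = 0).
    { replace ((z - w) * (z * w - 1))
        with (2 * z * w * ((z + / z) / 2 - (w + / w) / 2)) by (field; auto).
      rewrite E. ring. }
    destruct (Ceq_dec z w) as [<- | Hzw]; [reflexivity|].
    assert (H1 : z * w - 1 = 0).
    { destruct (Ceq_dec (z * w - 1) 0) as [H1|H1]; [exact H1|].
      exfalso; revert H; apply Cmult_neq_0; [|exact H1].
      intros H2; apply Hzw.
      replace z with (z - w + w) by ring. rewrite H2; ring. }
    replace w with (/ z); [now apply cdqinv_Hahn_param_sym|].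
    replace w with ((z * w - 1 + 1) / z) by (field; auto).
    rewrite H1; field; auto.
  - exists z; auto.
Qed.

(* Main.v *)
Require Import Defs.
From Stdlib Require Import Reals Arith List Lra Lia.
From Coquelicot Require Import Coquelicot.
Import ListNotations.
Open Scope C_scope.

(** Put [s = abct].  The factors [q^(2 binom2 n)] and [(1/ab,1/ac;q)_n] of the
    left-hand side cancel against those in the definition of [p_n], and its
    [n]-th term becomes [s^n (gamma;q)_n / (q;q)_n] times a terminating series
    over [k <= n].  There
<<
      (q^-n;q)_k q^(nk) / (q;q)_n = (-1)^k q^(binom2 k) / (q;q)_(n-k)
>>
    ([qpoch_inv_qpow]), so that term is the sum over [k + m = n] of
<<
      B_k * s^m (gamma;q)_(k+m) / (q;q)_m,
>>
    where [B_k] is the [k]-th term of [2phi2(z/a, 1/(az); 1/ab, 1/ac; q, at)]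
    ([cdqinv_Hahn_antidiagonal]).  Summing over [m] first, the q-binomial
    theorem ([q_binomial]) with parameter [gamma q^k] gives
<<
      B_k (gamma;q)_k (gamma q^k s;q)_oo / (s;q)_oo
        = (gamma s;q)_oo / (s;q)_oo * B_k (gamma;q)_k / (gamma s;q)_k,
>>
    and [B_k (gamma;q)_k / (gamma s;q)_k] is the [k]-th term of the [3phi3].

    The rearrangement is licensed by a bound of product form
    ([is_series_antidiagonal]): all finite products [(.;q)_n], and the inverses
    of those that never vanish, are bounded uniformly in [n]
    ([qpoch_bounded], [qpoch_inv_bounded]), so [B_k] is dominated by
    [|at|^k |q|^(binom2 k)] and the factor in [m] by [|s|^m].  Both this
    rearrangement and the limit in the q-binomial theorem come from Tannery's
    theorem ([is_series_dominated]).  Convergence of the [3phi3] is a by-product,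
    because [(gamma s;q)_oo] is nonzero. *)

(** * Limits of complex sequences *)

(** Reduces complex limits to real ones, where squeezing is available. *)
Lemma C_lim_Cmod (u : nat -> C) (l : C) :
  filterlim u eventually (locally l) <->
  is_lim_seq (fun n => Cmod (u n - l)) 0%R.
Proof.
  rewrite (@filterlim_locally_ball_norm C_AbsRing nat C_NormedModule
             eventually _ u l).
  rewrite <- is_lim_seq_spec.
  split; intros H eps; destruct (H eps) as [N HN]; exists N; intros n Hn;
    specialize (HN n Hn).
  - rewrite Rminus_0_r, (Rabs_pos_eq _ (Cmod_ge_0 _)). exact HN.
  - rewrite Rminus_0_r, (Rabs_pos_eq _ (Cmod_ge_0 _)) in HN. exact HN.
Qed.

Lemma Cmod_lim_le (u : nat -> C) (l : C) (M : R) :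
  filterlim u eventually (locally l) -> (forall n, (Cmod (u n) <= M)%R) ->
  (Cmod l <= M)%R.
Proof.
  intros Hl HM. apply C_lim_Cmod in Hl.
  apply (is_lim_seq_le (fun _ => Cmod l) (fun n => (M + Cmod (u n - l))%R)
           (Cmod l) M).
  - intros n.
    replace l with (u n + - (u n - l)) at 1 by ring.
    apply Rle_trans with (1 := Cmod_triangle _ _).
    rewrite Cmod_opp. apply Rplus_le_compat_r, HM.
  - apply is_lim_seq_const.
  - replace (Finite M) with (Finite (M + 0)) by (f_equal; ring).
    apply is_lim_seq_plus'; [apply is_lim_seq_const | exact Hl].
Qed.

Lemma C_lim_mult (u v : nat -> C) (l m : C) :
  filterlim u eventually (locally l) -> filterlim v eventually (locally m) ->
  filterlim (fun n => u n * v n) eventually (locally (l * m)).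
Proof.
  rewrite !C_lim_Cmod. intros Hu Hv.
  apply is_lim_seq_le_le with (fun _ => 0%R) (fun n =>
    (Cmod (u n - l) * Cmod (v n - m) + Cmod l * Cmod (v n - m)
     + Cmod m * Cmod (u n - l))%R).
  - intros n. split; [apply Cmod_ge_0|]. rewrite <- !Cmod_mult.
    replace (u n * v n - l * m)
      with ((u n - l) * (v n - m) + l * (v n - m) + m * (u n - l)) by ring.
    apply Rle_trans with (1 := Cmod_triangle _ _).
    apply Rplus_le_compat_r, Cmod_triangle.
  - apply is_lim_seq_const.
  - replace (Finite 0) with (Finite (0 * 0 + Cmod l * 0 + Cmod m * 0))
      by (f_equal; ring).
    apply is_lim_seq_plus'; [apply is_lim_seq_plus'|];
      apply is_lim_seq_mult'; auto using is_lim_seq_const.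
Qed.

Lemma C_lim_unique (u : nat -> C) (l m : C) :
  filterlim u eventually (locally l) -> filterlim u eventually (locally m) ->
  l = m.
Proof.
  intros Hl Hm. rewrite <- (CLim_seq_unique u l Hl). now apply CLim_seq_unique.
Qed.

(** * Dominated series *)

Lemma sum_n_le_Series (a : nat -> R) (n : nat) :
  (forall k, (0 <= a k)%R) -> ex_series a -> (sum_n a n <= Series a)%R.
Proof.
  intros Ha Hex.
  apply (is_lim_seq_incr_compare (sum_n a)).
  - exact (Series_correct a Hex).
  - intros m. rewrite sum_Sn. unfold plus; simpl. specialize (Ha (S m)). lra.
Qed.

Lemma Cmod_sum_n_le (a : nat -> C) (b : nat -> R) (n : nat) :
  (forall k, (Cmod (a k) <= b k)%R) -> (Cmod (sum_n a n) <= sum_n b n)%R.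
Proof.
  intros H. induction n as [|n IH].
  - rewrite !sum_O. apply H.
  - rewrite !sum_Sn. unfold plus; simpl.
    apply Rle_trans with (1 := Cmod_triangle _ _).
    apply Rplus_le_compat; [exact IH | apply H].
Qed.

Lemma Cmod_is_series_le (a : nat -> C) (b : nat -> R) (l : C) :
  is_series a l -> (forall k, (Cmod (a k) <= b k)%R) -> ex_series b ->
  (Cmod l <= Series b)%R.
Proof.
  intros Hl Hab Hb. apply (Cmod_lim_le (sum_n a)); [exact Hl|].
  intros n. apply Rle_trans with (1 := Cmod_sum_n_le a b n Hab).
  apply sum_n_le_Series; [|exact Hb].
  intros k. apply Rle_trans with (2 := Hab k), Cmod_ge_0.
Qed.

(** The head [k <= K] of the series tends to 0 as a finite sum of null
    sequences, while the tail is at most the tail of [E], small uniformly in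
    [N]. *)
Lemma Series_dominated_0 (u : nat -> nat -> R) (E : nat -> R) :
  (forall N k, (0 <= u N k <= E k)%R) ->
  (forall k, is_lim_seq (fun N => u N k) 0%R) -> ex_series E ->
  is_lim_seq (fun N => Series (u N)) 0%R.
Proof.
  intros Hu Hlim HE.
  assert (HuS : forall N, ex_series (u N)).
  { intros N. apply (ex_series_le (u N) E); [|exact HE].
    intros k. change (Rabs (u N k) <= E k)%R.
    rewrite Rabs_pos_eq; apply Hu. }
  apply is_lim_seq_spec. intros eps.
  assert (He : (0 < eps / 2)%R) by (destruct eps; simpl; lra).
  assert (HT : is_lim_seq (sum_n E) (Series E)) by exact (Series_correct E HE).
  apply is_lim_seq_spec in HT. destruct (HT (mkposreal _ He)) as [K HK].
  specialize (HK K (le_n K)). simpl in HK.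
  assert (Hhead : is_lim_seq (fun N => sum_n (u N) K) 0%R).
  { clear HK. induction K as [|K IH].
    - apply is_lim_seq_ext with (2 := Hlim 0%nat).
      intros n. now rewrite sum_O.
    - apply is_lim_seq_ext with (fun N => (sum_n (u N) K + u N (S K))%R).
      + intros n. now rewrite sum_Sn.
      + replace (Finite 0) with (Finite (0 + 0)) by (f_equal; ring).
        apply is_lim_seq_plus'; [exact IH | apply Hlim]. }
  apply is_lim_seq_spec in Hhead.
  destruct (Hhead (mkposreal _ He)) as [N0 HN0]. exists N0. intros N HN.
  specialize (HN0 N HN). simpl in HN0.
  assert (H0 : (0 <= Series (u N))%R).
  { apply Rle_trans with (sum_n (u N) 0).
    - rewrite sum_O. apply Hu.
    - apply sum_n_le_Series; [intros; apply Hu | apply HuS]. }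
  rewrite Rminus_0_r in HN0 |- *. rewrite (Rabs_pos_eq _ H0).
  rewrite (Series_incr_n (u N) (S K)) by (lia || apply HuS).
  rewrite (Series_incr_n E (S K)) in HK by (lia || exact HE).
  simpl pred in *. rewrite <- sum_n_Reals in HK |- *.
  assert (Htail : (Series (fun k => u N (S K + k)%nat)
                   <= Series (fun k => E (S K + k)%nat))%R).
  { apply Series_le; [intros; apply Hu|].
    now apply (ex_series_incr_n E (S K)). }
  apply Rabs_def2 in HN0. apply Rabs_def2 in HK. lra.
Qed.

(** Tannery's theorem: dominated convergence for series. *)
Lemma is_series_dominated (phi : nat -> nat -> C) (S g : nat -> C)
    (D : nat -> R) :
  (forall N, is_series (phi N) (S N)) ->
  (forall k, filterlim (fun N => phi N k) eventually (locally (g k))) ->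
  (forall N k, (Cmod (phi N k) <= D k)%R) -> ex_series D ->
  exists G, is_series g G /\ filterlim S eventually (locally G).
Proof.
  intros HS Hg HD HexD.
  assert (HgD : forall k, (Cmod (g k) <= D k)%R).
  { intros k. apply (Cmod_lim_le (fun N => phi N k)); auto. }
  destruct (@ex_series_le C_AbsRing C_CompleteNormedModule g D HgD HexD)
    as [G HG].
  exists G. split; [exact HG|]. apply C_lim_Cmod.
  assert (Hd : forall N k, (0 <= Cmod (phi N k - g k) <= D k + D k)%R).
  { intros N k. split; [apply Cmod_ge_0|].
    apply Rle_trans with (1 := Cmod_triangle _ _). rewrite Cmod_opp.
    apply Rplus_le_compat; auto. }
  assert (Hex2 : ex_series (fun k => D k + D k)%R).
  { now apply (@ex_series_plus R_AbsRing R_NormedModule). }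
  apply is_lim_seq_le_le with (fun _ => 0%R)
    (fun N => Series (fun k => Cmod (phi N k - g k))).
  - intros N. split; [apply Cmod_ge_0|].
    apply (Cmod_is_series_le (fun k => phi N k - g k)).
    + exact (is_series_minus (phi N) g (S N) G (HS N) HG).
    + intros k. apply Rle_refl.
    + apply (ex_series_le (K := R_AbsRing) (V := R_CompleteNormedModule) _
               (fun k => D k + D k)%R); [|exact Hex2].
      intros k. change (Rabs (Cmod (phi N k - g k)) <= D k + D k)%R.
      rewrite Rabs_pos_eq; apply Hd.
  - apply is_lim_seq_const.
  - apply Series_dominated_0 with (2 := fun k => proj1 (C_lim_Cmod _ _) (Hg k))
      (3 := Hex2). exact Hd.
Qed.

Lemma is_series_finite (a : nat -> C) (N : nat) :
  (forall k, (N < k)%nat -> a k = 0) -> is_series a (sum_n a N).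
Proof.
  intros H. apply C_lim_Cmod.
  apply is_lim_seq_ext_loc with (fun _ => 0%R); [|apply is_lim_seq_const].
  exists N. intros n Hn. induction Hn as [|n Hn IH].
  - rewrite <- Cmod_0 at 1. f_equal. symmetry. apply Cplus_opp_r.
  - rewrite sum_Sn, (H (S n)) by lia. apply (eq_trans IH).
    f_equal. f_equal. symmetry. apply Cplus_0_r.
Qed.

(** Both sides sum [f] over the triangle [k + m <= N]. *)
Lemma sum_n_antidiagonal (f : nat -> nat -> C) (N : nat) :
  sum_n (fun n => sum_n (fun k => f k (n - k)%nat) n) N =
  sum_n (fun k => sum_n (f k) (N - k)) N.
Proof.
  induction N as [|N IH].
  - now rewrite !sum_O.
  - rewrite sum_Sn, IH, !sum_Sn, Nat.sub_diag, sum_O.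
    rewrite (sum_n_ext_loc (fun k => sum_n (f k) (S N - k))
      (fun k => plus (sum_n (f k) (N - k)) (f k (S N - k)%nat))).
    + rewrite sum_n_plus. apply plus_assoc.
    + intros k Hk. rewrite Nat.sub_succ_l by exact Hk. now rewrite sum_Sn.
Qed.

(** Fubini for an array dominated by a product.  The partial sum over the
    triangle [k + m <= N] is a sum over [k] of truncated rows, each at most
    [D k] times the sum of [E], so Tannery's theorem applies. *)
Lemma is_series_antidiagonal (f : nat -> nat -> C) (g : nat -> C)
    (D E : nat -> R) :
  (forall k m, (Cmod (f k m) <= D k * E m)%R) ->
  (forall k, (0 <= D k)%R) -> (forall m, (0 <= E m)%R) ->
  ex_series D -> ex_series E -> (forall k, is_series (f k) (g k)) ->
  exists G, is_series g G /\
            is_series (fun n => sum_n (fun k => f k (n - k)%nat) n) G.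
Proof.
  intros Hf HD HE HexD HexE Hg.
  set (phi := fun N k : nat => if le_dec k N then sum_n (f k) (N - k) else RtoC 0).
  destruct (is_series_dominated phi
    (fun N => sum_n (fun k => sum_n (f k) (N - k)) N) g
    (fun k => D k * Series E)%R) as [G [HG HS]].
  - intros N.
    rewrite (sum_n_ext_loc _ (phi N)).
    + apply is_series_finite. intros k Hk. unfold phi.
      destruct (le_dec k N); [lia | reflexivity].
    + intros k Hk. unfold phi. destruct (le_dec k N); [reflexivity | lia].
  - intros k. apply C_lim_Cmod.
    apply (is_lim_seq_incr_n _ k).
    apply is_lim_seq_ext with (fun n => Cmod (sum_n (f k) n - g k)).
    + intros n. unfold phi. destruct (le_dec k (n + k)); [|lia].
      now replace (n + k - k)%nat with n by lia.
    + apply C_lim_Cmod, Hg.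
  - intros N k. unfold phi. destruct (le_dec k N).
    + apply Rle_trans with (sum_n (fun m => D k * E m)%R (N - k)).
      * now apply Cmod_sum_n_le.
      * rewrite (sum_n_mult_l (K := R_Ring) (D k) E).
        apply Rmult_le_compat_l; [apply HD | now apply sum_n_le_Series].
    + rewrite Cmod_0. apply Rmult_le_pos; [apply HD|].
      apply Rle_trans with (sum_n E 0);
        [rewrite sum_O; apply HE | now apply sum_n_le_Series].
  - now apply ex_series_scal_r.
  - exists G. split; [exact HG|].
    apply filterlim_ext with (2 := HS). intros N.
    symmetry; apply sum_n_antidiagonal.
Qed.

(** * Bounds and limits of q-shifted factorials *)

Lemma binom2_S (k : nat) : binom2 (S k) = (binom2 k + k)%nat.
Proof.
  unfold binom2. destruct k as [|k]; [reflexivity|].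
  replace (S (S k) * (S (S k) - 1))%nat
    with (S k * (S k - 1) + S k * 2)%nat by nia.
  now rewrite Nat.div_add by lia.
Qed.

(** The ratio of consecutive terms is [x * r ^ k], which tends to 0 however
    large [x] is. *)
Lemma ex_series_theta (x r : R) : (0 < x)%R -> (0 < r < 1)%R ->
  ex_series (fun k => x ^ k * r ^ binom2 k)%R.
Proof.
  intros Hx Hr.
  assert (Hpos : forall k, (0 < x ^ k * r ^ binom2 k)%R).
  { intros k. apply Rmult_lt_0_compat; apply pow_lt; lra. }
  apply ex_series_ext with (fun k => Rabs (x ^ k * r ^ binom2 k)).
  { intros k. apply Rabs_pos_eq, Rlt_le, Hpos. }
  apply ex_series_DAlembert with 0%R; [lra| |].
  - intros k. apply Rgt_not_eq, Hpos.
  - apply is_lim_seq_ext with (fun k => x * r ^ k)%R.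
    + intros k. rewrite Rabs_pos_eq by (apply Rlt_le, Rdiv_lt_0_compat; apply Hpos).
      rewrite binom2_S, pow_add. simpl. field.
      split; apply pow_nonzero; lra.
    + replace (Finite 0) with (Finite (x * 0)) by (f_equal; ring).
      apply is_lim_seq_mult'; [apply is_lim_seq_const|].
      apply is_lim_seq_geom. rewrite Rabs_pos_eq; lra.
Qed.

(** From [1 + y <= exp y] and the sum of the geometric series; it serves both
    for [(a;q)_n] and for its inverse. *)
Lemma Cmod_prod_bounded (p v : nat -> C) (K r : R) :
  (0 <= K)%R -> (0 <= r < 1)%R ->
  p 0%nat = 1 -> (forall n, p (S n) = p n * v n) ->
  (forall n, (Cmod (v n) <= 1 + K * r ^ n)%R) ->
  forall n, (Cmod (p n) <= exp (K / (1 - r)))%R.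
Proof.
  intros HK Hr Hp0 Hp Hv.
  assert (H : forall n, (Cmod (p n) <= exp (K * (1 - r ^ n) / (1 - r)))%R).
  { induction n as [|n IH].
    - rewrite Hp0, Cmod_1. replace (K * (1 - r ^ 0) / (1 - r))%R with 0%R
        by (simpl; field; lra). rewrite exp_0. lra.
    - rewrite Hp, Cmod_mult.
      replace (K * (1 - r ^ S n) / (1 - r))%R
        with (K * (1 - r ^ n) / (1 - r) + K * r ^ n)%R by (simpl; field; lra).
      rewrite exp_plus.
      apply Rmult_le_compat; auto using Cmod_ge_0.
      apply Rle_trans with (1 := Hv n). apply exp_ineq1_le. }
  intros n. apply Rle_trans with (1 := H n).
  assert (Hn : (0 <= r ^ n)%R) by (apply pow_le; lra).
  assert (Hd : (0 < / (1 - r))%R) by (apply Rinv_0_lt_compat; lra).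
  assert (Hle : (K * (1 - r ^ n) / (1 - r) <= K / (1 - r))%R).
  { unfold Rdiv. apply Rmult_le_compat_r; [lra|]. nra. }
  destruct Hle as [Hlt | ->]; [apply Rlt_le, exp_increasing, Hlt | lra].
Qed.

Lemma qpoch_add (a q : C) (m n : nat) :
  qpoch a q (m + n) = qpoch a q m * qpoch (a * q ^ m) q n.
Proof.
  induction n as [|n IH]; simpl.
  - rewrite Nat.add_0_r. ring.
  - rewrite Nat.add_succ_r. simpl. rewrite IH, Cpow_add_r. ring.
Qed.

Lemma qpoch_neq_0 (a q : C) (n : nat) :
  (forall k, a * q ^ k <> 1) -> qpoch a q n <> 0.
Proof.
  intros H. induction n as [|n IH]; simpl.
  - apply C1_nz.
  - apply Cmult_neq_0; [exact IH|]. intros E. apply (H n).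
    replace (a * q ^ n) with (1 - (1 - a * q ^ n)) by ring. rewrite E. ring.
Qed.

Lemma qpoch_bounded (a q : C) : (Cmod q < 1)%R ->
  exists M : R, forall n, (Cmod (qpoch a q n) <= M)%R.
Proof.
  intros Hq. exists (exp (Cmod a / (1 - Cmod q))).
  apply (Cmod_prod_bounded (qpoch a q) (fun n => 1 - a * q ^ n)).
  - apply Cmod_ge_0.
  - split; [apply Cmod_ge_0 | exact Hq].
  - reflexivity.
  - reflexivity.
  - intros n. apply Rle_trans with (1 := Cmod_triangle _ _).
    rewrite Cmod_1, Cmod_opp, Cmod_mult, Cmod_pow. lra.
Qed.

Lemma Cmod_geom_lim (a q : C) : (Cmod q < 1)%R ->
  is_lim_seq (fun n => Cmod (a * q ^ n)) 0%R.
Proof.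
  intros Hq. apply is_lim_seq_ext with (fun n => Cmod a * Cmod q ^ n)%R.
  - intros n. now rewrite Cmod_mult, Cmod_pow.
  - replace (Finite 0) with (Finite (Cmod a * 0)) by (f_equal; ring).
    apply is_lim_seq_mult'; [apply is_lim_seq_const|].
    apply is_lim_seq_geom. rewrite Rabs_pos_eq; [exact Hq | apply Cmod_ge_0].
Qed.

(** No factor vanishes and the factors tend to 1, so only finitely many of them
    can have modulus below [1/2]. *)
Lemma qfactor_lower_bound (a q : C) : (Cmod q < 1)%R ->
  (forall k, a * q ^ k <> 1) ->
  exists d : R, (0 < d)%R /\ forall n, (d <= Cmod (1 - a * q ^ n))%R.
Proof.
  intros Hq Ha.
  assert (Hlim := Cmod_geom_lim a q Hq). apply is_lim_seq_spec in Hlim.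
  assert (H2 : (0 < 1 / 2)%R) by lra.
  destruct (Hlim (mkposreal _ H2)) as [N HN]. simpl in HN.
  assert (Hfin : forall J, exists d : R,
    (0 < d)%R /\ forall n, (n < J)%nat -> (d <= Cmod (1 - a * q ^ n))%R).
  { induction J as [|J [d [Hd IH]]].
    - exists 1%R. split; [lra | intros; lia].
    - exists (Rmin d (Cmod (1 - a * q ^ J))). split.
      + apply Rmin_glb_lt; [exact Hd|]. apply Cmod_gt_0. intros E. apply (Ha J).
        replace (a * q ^ J) with (1 - (1 - a * q ^ J)) by ring. rewrite E. ring.
      + intros n Hn. destruct (Nat.eq_dec n J) as [-> | Hne].
        * apply Rmin_r.
        * apply Rle_trans with (1 := Rmin_l _ _). apply IH. lia. }
  destruct (Hfin N) as [d [Hd HdN]].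
  exists (Rmin d (1 / 2)). split; [apply Rmin_glb_lt; lra|].
  intros n. destruct (lt_dec n N) as [Hn | Hn].
  - apply Rle_trans with (1 := Rmin_l _ _). auto.
  - apply Rle_trans with (1 := Rmin_r _ _).
    assert (Hn' : (N <= n)%nat) by lia. specialize (HN n Hn').
    rewrite Rminus_0_r, (Rabs_pos_eq _ (Cmod_ge_0 _)) in HN.
    assert (HT := Cmod_triangle (1 - a * q ^ n) (a * q ^ n)).
    replace (1 - a * q ^ n + a * q ^ n) with (RtoC 1) in HT by ring.
    rewrite Cmod_1 in HT. lra.
Qed.

(** The inverse factors are [1/(1-y) = 1 + y/(1-y)] with [y = a q^n], and a lower
    bound [d] on [|1 - y|] makes [y/(1-y)] of size [|a|/d * |q|^n]. *)
Lemma qpoch_inv_bounded (a q : C) : (Cmod q < 1)%R ->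
  (forall k, a * q ^ k <> 1) ->
  exists M : R, (0 < M)%R /\ forall n, (Cmod (/ qpoch a q n) <= M)%R.
Proof.
  intros Hq Ha.
  destruct (qfactor_lower_bound a q Hq Ha) as [d [Hd Hlow]].
  exists (exp (Cmod a / d / (1 - Cmod q))). split; [apply exp_pos|].
  assert (Hnz : forall n, 1 - a * q ^ n <> 0).
  { intros n. apply Cmod_gt_0. specialize (Hlow n). lra. }
  apply (Cmod_prod_bounded (fun n => / qpoch a q n)
           (fun n => / (1 - a * q ^ n))).
  - apply Rmult_le_pos; [apply Cmod_ge_0 | apply Rlt_le, Rinv_0_lt_compat, Hd].
  - split; [apply Cmod_ge_0 | exact Hq].
  - simpl. field.
  - intros n. simpl. field. split; [apply Hnz | now apply qpoch_neq_0].
  - intros n.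
    replace (/ (1 - a * q ^ n)) with (1 + a * q ^ n * / (1 - a * q ^ n))
      by (field; apply Hnz).
    apply Rle_trans with (1 := Cmod_triangle _ _).
    rewrite Cmod_1, !Cmod_mult, Cmod_pow, Cmod_inv by apply Hnz.
    apply Rplus_le_compat_l.
    replace (Cmod a / d * Cmod q ^ n)%R with (Cmod a * Cmod q ^ n * / d)%R
      by (field; lra).
    apply Rmult_le_compat_l.
    + apply Rmult_le_pos; [|apply pow_le]; apply Cmod_ge_0.
    + apply Rinv_le_contravar; [exact Hd | apply Hlow].
Qed.

(** The increments [- (a;q)_n a q^n] are geometrically small because [(a;q)_n] is
    bounded, so the sequence of partial products telescopes to a limit. *)
Lemma qpoch_lim (a q : C) : (Cmod q < 1)%R ->
  filterlim (qpoch a q) eventually (locally (qpoch_inf a q)).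
Proof.
  intros Hq.
  destruct (qpoch_bounded a q Hq) as [M HM].
  set (d := fun n => qpoch a q (S n) - qpoch a q n).
  assert (Hex : ex_series d).
  { apply (@ex_series_le C_AbsRing C_CompleteNormedModule d
             (fun n => M * Cmod a * Cmod q ^ n)%R).
    - intros n. change (Cmod (d n) <= M * Cmod a * Cmod q ^ n)%R.
      unfold d; simpl.
      replace (qpoch a q n * (1 - a * q ^ n) - qpoch a q n)
        with (- (qpoch a q n * (a * q ^ n))) by ring.
      rewrite Cmod_opp, !Cmod_mult, Cmod_pow, Rmult_assoc.
      apply Rmult_le_compat_r; [|apply HM].
      apply Rmult_le_pos; [|apply pow_le]; apply Cmod_ge_0.
    - apply (ex_series_scal (K := R_AbsRing) (V := R_NormedModule)
               (M * Cmod a)%R (fun n => Cmod q ^ n)%R).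
      apply ex_series_geom. rewrite Rabs_pos_eq; [exact Hq | apply Cmod_ge_0]. }
  destruct Hex as [l Hl].
  assert (Hlim : filterlim (qpoch a q) eventually (locally (l + 1))).
  { apply C_lim_Cmod. apply is_lim_seq_incr_1.
    apply C_lim_Cmod in Hl.
    apply is_lim_seq_ext with (2 := Hl). intros n. f_equal.
    transitivity (qpoch a q (S n) - 1 - l); [|ring]. f_equal.
    induction n as [|n IH].
    - rewrite sum_O. unfold d. simpl. ring.
    - rewrite sum_Sn, IH. unfold plus, d. simpl. ring. }
  unfold qpoch_inf. now rewrite (CLim_seq_unique _ _ Hlim).
Qed.

Lemma qpoch_inf_neq_0 (a q : C) : (Cmod q < 1)%R ->
  (forall k, a * q ^ k <> 1) -> qpoch_inf a q <> 0.
Proof.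
  intros Hq Ha E.
  destruct (qpoch_inv_bounded a q Hq Ha) as [M [HM0 HM]].
  assert (Hlim := qpoch_lim a q Hq). rewrite E in Hlim.
  (* 1 = (a;q)_n / (a;q)_n is at most M |(a;q)_n|, which would tend to 0. *)
  apply C_lim_Cmod in Hlim. apply is_lim_seq_spec in Hlim.
  destruct (Hlim (mkposreal _ (Rinv_0_lt_compat _ HM0))) as [N HN].
  specialize (HN N (le_n N)). simpl in HN.
  rewrite Rminus_0_r, (Rabs_pos_eq _ (Cmod_ge_0 _)) in HN.
  replace (qpoch a q N - 0) with (qpoch a q N) in HN by ring.
  specialize (HM N).
  assert (Hp := qpoch_neq_0 a q N Ha).
  rewrite Cmod_inv in HM by exact Hp.
  apply Cmod_gt_0 in Hp.
  apply Rinv_lt_contravar in HN; [|apply Rmult_lt_0_compat; auto].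
  - rewrite Rinv_inv in HN. lra.
  - now apply Rinv_0_lt_compat.
Qed.

Lemma qpoch_inf_shift (a q : C) (k : nat) : (Cmod q < 1)%R ->
  qpoch_inf a q = qpoch a q k * qpoch_inf (a * q ^ k) q.
Proof.
  intros Hq. apply (C_lim_unique (fun n => qpoch a q (k + n))).
  - apply C_lim_Cmod.
    apply is_lim_seq_ext with (fun n => Cmod (qpoch a q (n + k) - qpoch_inf a q)).
    + intros n. now rewrite (Nat.add_comm n k).
    + apply (is_lim_seq_incr_n (fun n => Cmod (qpoch a q n - qpoch_inf a q)) k).
      apply C_lim_Cmod, qpoch_lim, Hq.
  - apply filterlim_ext with (fun n => qpoch a q k * qpoch (a * q ^ k) q n).
    + intros n. symmetry; apply qpoch_add.
    + apply C_lim_mult; [apply filterlim_const | apply qpoch_lim, Hq].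
Qed.

Lemma Cmod_lt_1_qpow (w q : C) (k : nat) :
  (Cmod w < 1)%R -> (Cmod q < 1)%R -> w * q ^ k <> 1.
Proof.
  intros Hw Hq E. assert (H := f_equal Cmod E).
  rewrite Cmod_1, Cmod_mult, Cmod_pow in H.
  assert (Hk : (Cmod q ^ k <= 1)%R).
  { rewrite <- (pow1 k). apply pow_incr. split; [apply Cmod_ge_0 | lra]. }
  assert (Hk0 : (0 <= Cmod q ^ k)%R) by (apply pow_le, Cmod_ge_0).
  assert (Hw0 := Cmod_ge_0 w). nra.
Qed.

(** * The q-binomial theorem *)

Definition qcoef (a q : C) (m : nat) : C := qpoch a q m / qpoch q q m.

Lemma qcoef_bounded (a q : C) : (Cmod q < 1)%R ->
  exists M : R, (0 <= M)%R /\ forall m, (Cmod (qcoef a q m) <= M)%R.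
Proof.
  intros Hq. destruct (qpoch_bounded a q Hq) as [M HM].
  destruct (qpoch_inv_bounded q q Hq) as [M' [HM'0 HM']].
  { intros k. now apply Cmod_lt_1_qpow. }
  exists (M * M')%R. split.
  - apply Rmult_le_pos; [|lra]. apply Rle_trans with (2 := HM 0%nat), Cmod_ge_0.
  - intros m. unfold qcoef, Cdiv. rewrite Cmod_mult.
    apply Rmult_le_compat; auto using Cmod_ge_0.
Qed.

Lemma q_binomial_ex_series (a q w : C) : (Cmod q < 1)%R -> (Cmod w < 1)%R ->
  is_series (fun m => w ^ m * qcoef a q m) (CSeries (fun m => w ^ m * qcoef a q m)).
Proof.
  intros Hq Hw. destruct (qcoef_bounded a q Hq) as [M [HM0 HM]].
  destruct (@ex_series_le C_AbsRing C_CompleteNormedModule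
              (fun m => w ^ m * qcoef a q m) (fun m => Cmod w ^ m * M)%R) as [l Hl].
  - intros m. change (Cmod (w ^ m * qcoef a q m) <= Cmod w ^ m * M)%R.
    rewrite Cmod_mult, Cmod_pow.
    apply Rmult_le_compat_l; [apply pow_le, Cmod_ge_0 | apply HM].
  - apply ex_series_scal_r, ex_series_geom.
    rewrite Rabs_pos_eq; [exact Hw | apply Cmod_ge_0].
  - now rewrite (CSeries_unique _ l Hl).
Qed.

(** Comparing coefficients, this is the recursion
    [(1 - q^(m+1)) c_(m+1) = (1 - a q^m) c_m] of [c = qcoef a q]. *)
Lemma q_binomial_functional_eq (a q w : C) : (Cmod q < 1)%R -> (Cmod w < 1)%R ->
  (1 - w) * CSeries (fun m => w ^ m * qcoef a q m) =
  (1 - a * w) * CSeries (fun m => (q * w) ^ m * qcoef a q m).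
Proof.
  intros Hq Hw.
  assert (Hqw : (Cmod (q * w) < 1)%R).
  { rewrite Cmod_mult. assert (H1 := Cmod_ge_0 q). assert (H2 := Cmod_ge_0 w).
    nra. }
  assert (H1 := q_binomial_ex_series a q w Hq Hw).
  assert (H2 := q_binomial_ex_series a q (q * w) Hq Hqw).
  set (l1 := CSeries (fun m => w ^ m * _)) in *.
  set (l2 := CSeries (fun m => (q * w) ^ m * _)) in *.
  (* The difference of the two series is summed twice: termwise, and from its
     index 1 on by the coefficient recursion (its term of index 0 is 0). *)
  assert (Hd : is_series (fun m => (w ^ m - (q * w) ^ m) * qcoef a q m) (l1 - l2)).
  { apply is_series_ext with (2 := is_series_minus _ _ _ _ H1 H2).
    intros m. unfold plus, opp; simpl. ring. }
  assert (Hd' : is_series (fun m => (w ^ m - (q * w) ^ m) * qcoef a q m)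
                  (w * l1 - a * w * l2)).
  { apply (is_series_decr_1 (K := C_AbsRing) (V := C_NormedModule)).
    match goal with |- is_series _ ?L =>
      replace L with (plus (scal w l1 : C) (opp (scal (a * w) l2 : C)))
        by (unfold plus, opp, scal; simpl; unfold mult; simpl; ring) end.
    apply is_series_ext with (2 := is_series_minus _ _ _ _
      (is_series_scal w _ _ H1) (is_series_scal (a * w) _ _ H2)).
    intros m. unfold plus, opp, scal; simpl. unfold mult; simpl.
    rewrite !Cpow_mult_l. unfold qcoef. simpl. field.
    split.
    - intros E. apply (Cmod_lt_1_qpow q q m Hq Hq).
      replace (q * q ^ m) with (1 - (1 - q * q ^ m)) by ring. rewrite E. ring.
    - apply qpoch_neq_0. intros k. now apply Cmod_lt_1_qpow. }
  assert (E := C_lim_unique _ _ _ Hd Hd').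
  transitivity (l1 - l2 + l2 - w * l1); [ring|]. rewrite E. ring.
Qed.

(** With [F(w)] the sum of the series, iterating the functional equation gives
    [(w;q)_N F(w) = (aw;q)_N F(q^N w)]; as [N] grows, [F(q^N w)] tends to
    [F(0) = 1] by Tannery's theorem. *)
Lemma q_binomial (a q w : C) : (Cmod q < 1)%R -> (Cmod w < 1)%R ->
  is_series (fun m => w ^ m * qcoef a q m)
    (qpoch_inf (a * w) q / qpoch_inf w q).
Proof.
  intros Hq Hw.
  set (F := fun N => CSeries (fun m => (q ^ N * w) ^ m * qcoef a q m)).
  assert (HwN : forall N, (Cmod (q ^ N * w) <= Cmod w)%R).
  { intros N. rewrite Cmod_mult, Cmod_pow.
    assert (Hk : (Cmod q ^ N <= 1)%R).
    { rewrite <- (pow1 N). apply pow_incr. split; [apply Cmod_ge_0 | lra]. }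
    assert (H0 := Cmod_ge_0 w). nra. }
  assert (HF : forall N, is_series (fun m => (q ^ N * w) ^ m * qcoef a q m) (F N)).
  { intros N. apply q_binomial_ex_series; [exact Hq|].
    apply Rle_lt_trans with (1 := HwN N) (2 := Hw). }
  assert (Hiter : forall N, qpoch w q N * F 0%nat = qpoch (a * w) q N * F N).
  { induction N as [|N IH]; [reflexivity|].
    assert (Hfe := q_binomial_functional_eq a q (q ^ N * w) Hq
                     (Rle_lt_trans _ _ _ (HwN N) Hw)).
    fold (F N) in Hfe.
    assert (EF : CSeries (fun m => (q * (q ^ N * w)) ^ m * qcoef a q m) = F (S N)).
    { unfold F. simpl. now rewrite Cmult_assoc. }
    rewrite EF in Hfe. simpl.
    transitivity (qpoch w q N * F 0%nat * (1 - w * q ^ N)); [ring|].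
    rewrite IH.
    transitivity (qpoch (a * w) q N * ((1 - q ^ N * w) * F N)); [ring|].
    rewrite Hfe. ring. }
  assert (HF1 : filterlim F eventually (locally (RtoC 1))).
  { destruct (qcoef_bounded a q Hq) as [M [HM0 HM]].
    destruct (is_series_dominated (fun N m => (q ^ N * w) ^ m * qcoef a q m) F
      (fun m => if Nat.eq_dec m 0 then RtoC 1 else RtoC 0)
      (fun m => Cmod w ^ m * M)%R) as [G [HG HFG]].
    - exact HF.
    - intros [|m]; simpl.
      + apply filterlim_ext with (fun _ => RtoC 1); [|apply filterlim_const].
        intros N. unfold qcoef; simpl. field.
      + apply C_lim_Cmod.
        apply is_lim_seq_le_le with (fun _ => 0%R)
          (fun N => Cmod (w * ((w ^ m) * qcoef a q (S m)) * q ^ N)).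
        * intros N. split; [apply Cmod_ge_0|].
          replace (q ^ N * w * (q ^ N * w) ^ m * qcoef a q (S m) - 0)
            with ((w * (w ^ m * qcoef a q (S m)) * q ^ N) * (q ^ N) ^ m)
            by (rewrite Cpow_mult_l; ring).
          rewrite (Cmod_mult _ ((q ^ N) ^ m)), <- Cpow_mult_r, (Cmod_pow q (N * m)).
          rewrite <- Rmult_1_r. apply Rmult_le_compat_l; [apply Cmod_ge_0|].
          rewrite <- (pow1 (N * m)). apply pow_incr.
          split; [apply Cmod_ge_0 | lra].
        * apply is_lim_seq_const.
        * now apply Cmod_geom_lim.
    - intros N m. rewrite Cmod_mult, Cmod_pow.
      apply Rmult_le_compat; auto using Cmod_ge_0.
      + apply pow_le, Cmod_ge_0.
      + apply pow_incr. split; [apply Cmod_ge_0 | apply HwN].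
    - apply ex_series_scal_r, ex_series_geom.
      rewrite Rabs_pos_eq; [exact Hw | apply Cmod_ge_0].
    - replace (RtoC 1) with G; [exact HFG|].
      apply (C_lim_unique _ _ _ HG).
      assert (H1 := is_series_finite
        (fun m => if Nat.eq_dec m 0 then RtoC 1 else RtoC 0) 0).
      rewrite sum_O in H1. apply H1. intros [|k] Hk; [lia | reflexivity]. }
  assert (E : qpoch_inf w q * F 0%nat = qpoch_inf (a * w) q * 1).
  { apply (C_lim_unique (fun N => qpoch w q N * F 0%nat)).
    - apply C_lim_mult; [now apply qpoch_lim | apply filterlim_const].
    - apply filterlim_ext with (fun N => qpoch (a * w) q N * F N).
      + intros N. symmetry. apply Hiter.
      + apply C_lim_mult; [now apply qpoch_lim | exact HF1]. }
  assert (Hinf : qpoch_inf w q <> 0).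
  { apply qpoch_inf_neq_0; [exact Hq|]. intros k. now apply Cmod_lt_1_qpow. }
  replace (qpoch_inf (a * w) q / qpoch_inf w q) with (F 0%nat).
  - apply is_series_ext with (2 := HF 0%nat).
    intros m. simpl. now rewrite Cmult_1_l.
  - replace (qpoch_inf (a * w) q) with (qpoch_inf (a * w) q * 1) by ring.
    rewrite <- E. field. exact Hinf.
Qed.

(** * The generating function *)

(** Each factor of [(q^-n;q)_k q^(nk)] is [q^n - q^j = - q^j (1 - q^(n-j))], and
    the factors [1 - q^(n-j)] complete [(q;q)_(n-k)] to [(q;q)_n]. *)
Lemma qpoch_inv_qpow (q : C) (n k m : nat) : q <> 0 -> n = (k + m)%nat ->
  qpoch (/ q ^ n) q k * (q ^ n) ^ k * qpoch q q m =
  qpoch q q n * ((- (1)) ^ k * q ^ binom2 k).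
Proof.
  intros Hq. revert m. induction k as [|k IH]; intros m Hn.
  - subst n. simpl. ring.
  - rewrite binom2_S, Cpow_add_r. simpl.
    assert (Hn' : n = (k + S m)%nat) by lia.
    assert (Hqn : q ^ n <> 0) by now apply Cpow_nz.
    assert (Hqk : q ^ k <> 0) by now apply Cpow_nz.
    transitivity (- q ^ k * (qpoch q q n * ((- (1)) ^ k * q ^ binom2 k)));
      [|ring].
    rewrite <- (IH (S m) Hn'). simpl.
    assert (E : (1 - / q ^ n * q ^ k) * q ^ n = - q ^ k * (1 - q * q ^ m)).
    { rewrite Hn', Cpow_add_r. simpl. field. split; [|split]; auto using Cpow_nz. }
    transitivity (qpoch (/ q ^ n) q k * (q ^ n) ^ k * qpoch q q m
                  * ((1 - / q ^ n * q ^ k) * q ^ n)); [ring|].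
    rewrite E. ring.
Qed.

(** Termination of the series that defines the polynomials. *)
Lemma qpoch_inv_qpow_0 (q : C) (n k : nat) : q <> 0 -> (n < k)%nat ->
  qpoch (/ q ^ n) q k = 0.
Proof.
  intros Hq Hk. replace k with (S n + (k - S n))%nat by lia.
  rewrite qpoch_add. simpl. field. now apply Cpow_nz.
Qed.

Lemma neq_qpow_inv (u q : C) : q <> 0 ->
  (forall k, u <> / q ^ k) -> forall k, u * q ^ k <> 1.
Proof.
  intros Hq Hu k E. apply (Hu k).
  assert (Hk : q ^ k <> 0) by now apply Cpow_nz.
  replace u with (u * q ^ k / q ^ k) by (field; exact Hk).
  rewrite E. field. exact Hk.
Qed.

(** The numerators and the inverses of the denominators are bounded, so
    [q^(binom2 k)] forces convergence whatever the modulus of [w]. *)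
Lemma ex_series_Cmod_phi22 (q w u v d e : C) :
  (0 < Cmod q)%R -> (Cmod q < 1)%R -> w <> 0 ->
  (forall k, d * q ^ k <> 1) -> (forall k, e * q ^ k <> 1) ->
  ex_series (fun k => Cmod (qhyp_term [u; v] [d; e] q w k)).
Proof.
  intros Hq0 Hq Hw Hd He.
  destruct (qpoch_bounded u q Hq) as [Mu HMu].
  destruct (qpoch_bounded v q Hq) as [Mv HMv].
  destruct (qpoch_inv_bounded d q Hq Hd) as [Md [_ HMd]].
  destruct (qpoch_inv_bounded e q Hq He) as [Me [_ HMe]].
  assert (Hqq : forall k, q * q ^ k <> 1)
    by (intros k; now apply Cmod_lt_1_qpow).
  destruct (qpoch_inv_bounded q q Hq Hqq) as [Mq [_ HMq]].
  apply (ex_series_le (K := R_AbsRing) (V := R_CompleteNormedModule) _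
    (fun k => (Mu * Mv * (Mq * (Md * Me))) * (Cmod w ^ k * Cmod q ^ binom2 k))%R).
  - intros k.
    change (Rabs (Cmod (qhyp_term [u; v] [d; e] q w k)) <=
      (Mu * Mv * (Mq * (Md * Me))) * (Cmod w ^ k * Cmod q ^ binom2 k))%R.
    rewrite Rabs_pos_eq by apply Cmod_ge_0.
    assert (Ek : qhyp_term [u; v] [d; e] q w k =
      qpoch u q k * qpoch v q k
      * (/ qpoch q q k * (/ qpoch d q k * / qpoch e q k))
      * ((- (1)) ^ k * (w ^ k * q ^ binom2 k))).
    { unfold qhyp_term. simpl qpochs. simpl length. simpl Cpow_Z. field. repeat split; now apply qpoch_neq_0. }
    rewrite Ek, !Cmod_mult, !Cmod_pow, Cmod_opp, Cmod_1, pow1, Rmult_1_l.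
    apply Rmult_le_compat_r.
    { apply Rmult_le_pos; apply pow_le, Cmod_ge_0. }
    repeat apply Rmult_le_compat; auto using Cmod_ge_0;
      repeat apply Rmult_le_pos; apply Cmod_ge_0.
  - apply (ex_series_scal (K := R_AbsRing) (V := R_NormedModule)
      (Mu * Mv * (Mq * (Md * Me)))%R).
    apply ex_series_theta; [now apply Cmod_gt_0 | lra].
Qed.

(** The array whose antidiagonal sums are the terms of the left-hand side and
    whose row sums are, up to a constant factor, the terms of the [3phi3]. *)
Definition double_term (q z gamma a b c t : C) (k m : nat) : C :=
  qhyp_term [z / a; / (a * z)] [/ (a * b); / (a * c)] q (a * t) k
  * ((a * b * c * t) ^ m * (qpoch gamma q (k + m) / qpoch q q m)).

Lemma cdqinv_Hahn_antidiagonal (q z gamma a b c t : C) (n : nat) :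
  (Cmod q < 1)%R -> q <> 0 -> z <> 0 -> a <> 0 -> b <> 0 -> c <> 0 ->
  (forall k, / (a * b) * q ^ k <> 1) -> (forall k, / (a * c) * q ^ k <> 1) ->
  t ^ n * qpoch gamma q n * q ^ (2 * binom2 n)
    * cdqinv_Hahn n ((z + / z) / 2) a b c q
    / qpochs [q; / (a * b); / (a * c)] q n
  = sum_n (fun k => double_term q z gamma a b c t k (n - k)) n.
Proof.
  intros Hq Hq0 Hz Ha Hb Hc Hab Hac.
  assert (Hqq : forall k, q * q ^ k <> 1)
    by (intros k; now apply Cmod_lt_1_qpow).
  rewrite cdqinv_HahnE by assumption. unfold cdqinv_Hahn_param, qhyp.
  set (h := qhyp_term [/ q ^ n; z / a; / (a * z)]
              [/ (a * b); / (a * c)] q (q ^ n / (b * c))).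
  assert (Hfin : is_series h (sum_n h n)).
  { apply is_series_finite. intros k Hk. unfold h, qhyp_term. simpl qpochs.
    rewrite qpoch_inv_qpow_0 by assumption. unfold Cdiv. ring. }
  rewrite (CSeries_unique _ _ Hfin).
  (* X is what remains of the prefactors after cancellation. *)
  set (X := (t * (a * b * c)) ^ n * qpoch gamma q n / qpoch q q n).
  transitivity (X * sum_n h n).
  { unfold X. simpl qpochs. rewrite (Cpow_mult_l t).
    assert (HQ : qpoch q q n <> 0) by now apply qpoch_neq_0.
    assert (HA : qpoch (/ (a * b)) q n <> 0) by now apply qpoch_neq_0.
    assert (HB : qpoch (/ (a * c)) q n <> 0) by now apply qpoch_neq_0.
    assert (HY : q ^ (2 * binom2 n) <> 0) by now apply Cpow_nz.
    (* The powers are made opaque so that field does not expand them. *)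
    generalize dependent (qpoch (/ (a * b)) q n).
    generalize dependent (qpoch (/ (a * c)) q n).
    generalize dependent (q ^ (2 * binom2 n)).
    generalize (sum_n h n : C) ((a * b * c) ^ n).
    intros. field. repeat split; assumption. }
  rewrite <- (sum_n_mult_l (K := C_Ring)).
  apply sum_n_ext_loc. intros k Hk.
  change (X * h k = double_term q z gamma a b c t k (n - k)).
  unfold X, h, double_term, qhyp_term.
  simpl qpochs. simpl length. simpl Cpow_Z.
  assert (Hn : n = (k + (n - k))%nat) by lia.
  set (m := (n - k)%nat) in *.
  assert (Hkey := qpoch_inv_qpow q n k m Hq0 Hn).
  rewrite <- Hn.
  assert (Hs : (t * (a * b * c)) ^ n = (a * b * c * t) ^ m * (a * t) ^ k * (b * c) ^ k).
  { rewrite <- (Cmult_assoc _ ((a * t) ^ k)), <- (Cpow_mult_l (a * t)).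
    rewrite Hn, Cpow_add_r, Cmult_comm. f_equal; f_equal; ring. }
  assert (HQm : qpoch q q m <> 0) by now apply qpoch_neq_0.
  assert (HQn : qpoch q q n <> 0) by now apply qpoch_neq_0.
  assert (HQk : qpoch q q k <> 0) by now apply qpoch_neq_0.
  assert (HA : qpoch (/ (a * b)) q k <> 0) by now apply qpoch_neq_0.
  assert (HB : qpoch (/ (a * c)) q k <> 0) by now apply qpoch_neq_0.
  assert (Hbc : (b * c) ^ k <> 0) by now apply Cpow_nz, Cmult_neq_0.
  assert (Hw : (q ^ n / (b * c)) ^ k = (q ^ n) ^ k / (b * c) ^ k).
  { unfold Cdiv. rewrite Cpow_mult_l, Cpow_inv; [reflexivity|].
    now apply Cmult_neq_0. }
  rewrite Cmult_1_r. replace ((- (1)) ^ k * q ^ binom2 k)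
    with (qpoch (/ q ^ n) q k * (q ^ n) ^ k * qpoch q q m / qpoch q q n)
    by (rewrite Hkey; field; exact HQn).
  rewrite Hw, Hs.
  generalize dependent (qpoch (/ (a * b)) q k).
  generalize dependent (qpoch (/ (a * c)) q k).
  generalize (qpoch (/ (a * z)) q k) (qpoch (z / a) q k)
    (qpoch (/ q ^ n) q k) ((a * b * c * t) ^ m) ((a * t) ^ k) ((q ^ n) ^ k).
  intros. field. repeat split; assumption.
Qed.

Theorem theorem6p12 (q z x gamma a b c t : C)
  (hq0 : (0 < Cmod q)%R) (hq1 : (Cmod q < 1)%R)
  (hz : z <> 0) (hx : x = (z + / z) / 2) (hx0 : x <> 0)
  (hgamma : gamma <> 0) (ha : a <> 0) (hb : b <> 0) (hc : c <> 0) (ht : t <> 0)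
  (ht1 : (Cmod t < 1)%R) (habct : (Cmod (a * b * c * t) < 1)%R)
  (hab : forall k : nat, / (a * b) <> / q ^ k)
  (hac : forall k : nat, / (a * c) <> / q ^ k)
  (hgabct : forall k : nat, gamma * a * b * c * t <> / q ^ k) :
  let lhs_term := fun n : nat =>
    t ^ n * qpoch gamma q n * q ^ (2 * binom2 n) * cdqinv_Hahn n x a b c q
    / qpochs [q; / (a * b); / (a * c)] q n in
  let la := [gamma; z / a; / (a * z)] in
  let lb := [/ (a * b); / (a * c); gamma * a * b * c * t] in
  ex_series (qhyp_term la lb q (a * t)) /\
  is_series lhs_term
    (qpoch_inf (gamma * a * b * c * t) q / qpoch_inf (a * b * c * t) q
     * qhyp la lb q (a * t)).
Proof.
  intros lhs_term la lb.
  assert (hqn0 : q <> 0) by now apply Cmod_gt_0.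
  assert (Hqq : forall k, q * q ^ k <> 1)
    by (intros k; now apply Cmod_lt_1_qpow).
  assert (Hab := neq_qpow_inv _ q hqn0 hab).
  assert (Hac := neq_qpow_inv _ q hqn0 hac).
  assert (Hgs := neq_qpow_inv _ q hqn0 hgabct).
  set (s := a * b * c * t) in *.
  assert (Egs : gamma * a * b * c * t = gamma * s) by (unfold s; ring).
  assert (Hs : forall k, s * q ^ k <> 1) by (intros k; now apply Cmod_lt_1_qpow).
  set (P := qpoch_inf (gamma * a * b * c * t) q).
  set (Q := qpoch_inf s q).
  assert (HP : P <> 0) by now apply qpoch_inf_neq_0.
  assert (HQ : Q <> 0) by now apply qpoch_inf_neq_0.
  set (B := qhyp_term [z / a; / (a * z)] [/ (a * b); / (a * c)] q (a * t)).
  destruct (qpoch_bounded gamma q hq1) as [Mg HMg].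
  destruct (qpoch_inv_bounded q q hq1 Hqq) as [Mq [HMq0 HMq]].
  assert (HMg0 : (0 <= Mg)%R)
    by exact (Rle_trans _ _ _ (Cmod_ge_0 _) (HMg 0%nat)).
  destruct (is_series_antidiagonal (double_term q z gamma a b c t)
    (fun k => P / Q * qhyp_term la lb q (a * t) k)
    (fun k => Cmod (B k)) (fun m => Cmod s ^ m * (Mg * Mq))%R)
    as [G [HG HGlhs]].
  - intros k m. unfold double_term. fold s B.
    unfold Cdiv. rewrite !Cmod_mult, Cmod_pow.
    apply Rmult_le_compat_l; [apply Cmod_ge_0|].
    apply Rmult_le_compat_l; [apply pow_le, Cmod_ge_0|].
    apply Rmult_le_compat; auto using Cmod_ge_0.
  - intros k. apply Cmod_ge_0.
  - intros m. apply Rmult_le_pos; [apply pow_le, Cmod_ge_0|].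
    apply Rmult_le_pos; lra.
  - apply ex_series_Cmod_phi22; auto. now apply Cmult_neq_0.
  - apply ex_series_scal_r, ex_series_geom.
    rewrite Rabs_pos_eq; [exact habct | apply Cmod_ge_0].
  - intros k.
    assert (Hbin := is_series_scal (B k * qpoch gamma q k) _ _
                      (q_binomial (gamma * q ^ k) q s hq1 habct)).
    assert (E : P / Q * qhyp_term la lb q (a * t) k =
      scal (B k * qpoch gamma q k)
        (qpoch_inf (gamma * q ^ k * s) q / qpoch_inf s q)).
    { fold Q. change (P / Q * qhyp_term la lb q (a * t) k =
        B k * qpoch gamma q k * (qpoch_inf (gamma * q ^ k * s) q / Q)).
      assert (HPk : P = qpoch (gamma * a * b * c * t) q k
                        * qpoch_inf (gamma * q ^ k * s) q).
      { unfold P. rewrite (qpoch_inf_shift _ q k hq1). f_equal. f_equal.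
        unfold s. ring. }
      rewrite HPk. unfold B, la, lb, qhyp_term.
      simpl qpochs. simpl length. simpl Cpow_Z. field.
      repeat split; try exact HQ; now apply qpoch_neq_0. }
    rewrite E. apply is_series_ext with (2 := Hbin).
    intros m. change (B k * qpoch gamma q k * (s ^ m * qcoef (gamma * q ^ k) q m)
      = double_term q z gamma a b c t k m).
    unfold double_term, qcoef. fold s B. rewrite qpoch_add. field.
    now apply qpoch_neq_0.
  - assert (Hhyp : is_series (qhyp_term la lb q (a * t)) (Q / P * G)).
    { apply is_series_ext with (2 := is_series_scal (Q / P) _ _ HG).
      intros k. change (Q / P * (P / Q * qhyp_term la lb q (a * t) k)
                        = qhyp_term la lb q (a * t) k).
      field. now split. }
    split; [now exists (Q / P * G)|].
    unfold qhyp. rewrite (CSeries_unique _ _ Hhyp).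
    assert (EG : P / Q * (Q / P * G) = G) by (field; now split).
    rewrite EG.
    apply is_series_ext with (2 := HGlhs).
    intros n. unfold lhs_term. rewrite hx. symmetry.
    now apply cdqinv_Hahn_antidiagonal.
Qed.
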